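(* In the setting described in the context, assume that $\mathsf U_i^n\in\mathcal A$ for all $i\in\mathcal V$ and that $\tau\le\min_{i\in\mathcal V}\frac{m_i}{2|d_{ii}^{L,n}|}$. Then the low-order update $\mathsf U_i^{L,n+1}$ satisfies the following discrete entropy inequality for every $i\in\mathcal V$: $$\frac{m_i}{\tau}\big(E_{\rm flat}(\mathsf U_i^{L,n+1})-E_{\rm flat}(\mathsf U_i^n)\big)+\sum_{j\in\mathcal I(i)}\Big\{\big(F_{\rm flat}(\mathsf U_j^{*,i})-F_{\rm flat}(\mathsf U_i^{*,j})\big)\cdot c_{ij}-d_{ij}^{L,n}\big(E_{\rm flat}(\mathsf U_j^{*,i})-E_{\rm flat}(\mathsf U_i^{*,j})\big)\Big\}\le\nabla_uE_{\rm flat}(\mathsf U_i^n)\cdot\mathsf B_i^{L,n}+\mathcal O(\tau).$$ When there is no influence due to topography ($\mathsf Z_i=0$ for all $i\in\mathcal V$), the entropy inequality reduces to $$\frac{m_i}{\tau}\big(E_{\rm flat}(\mathsf U_i^{L,n+1})-E_{\rm flat}(\mathsf U_i^n)\big)+\sum_{j\in\mathcal I(i)}\Big\{\big(F_{\rm flat}(\mathsf U_j^n)-F_{\rm flat}(\mathsf U_i^n)\big)\cdot c_{ij}-d_{ij}^{L,n}\big(E_{\rm flat}(\mathsf U_j^n)-E_{\rm flat}(\mathsf U_i^n)\big)\Big\}\le0.$$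
   Context: Setting: low-order approximation of the shallow water equations in dimension $d\in\{1,2\}$ with forward Euler time stepping. The term $\mathcal O(\tau)$ is understood as $\tau\to0$. States, flux, entropy. $\mathcal A=\{(h,q)^T\in\mathbb R^{d+1}: h>0\}$. $g>0$ is the gravity constant. The flux is $\mathbb f(u)=(q,\ q\otimes v+\frac12 g h^2 I_d)^T$ with $v=q/h$, so for $c\in\mathbb R^d$: $\mathbb f(u)c=(q\cdot c,\ (v\cdot c)q+\frac12 gh^2c)^T$ (zero if $h=0$, $q=0$). The flat-topography entropy pair is $E_{\rm flat}(u)=\frac12gh^2+\frac12h\|v\|^2$, $F_{\rm flat}(u)=v\big(E_{\rm flat}(u)+\frac12gh^2\big)$ (both zero if $h=0$, $q=0$); $\nabla_u$ is the gradient with respect to $u=(h,q)$. Discretization. $\mathcal V=\{1,\dots,I\}$ indexes the degrees of freedom; for each $i\in\mathcal V$, $\mathcal I(i)\subsetneq\mathcal V$ is the stencil at $i$ (containing $i$), and $\mathcal I^*(i)=\mathcal I(i)\setminus\{i\}$. Given are masses $m_i>0$ and vectors $c_{ij}\in\mathbb R^d$ with $\sum_{j\in\mathcal I(i)}c_{ij}=0$, $c_{ij}=0$ if $j\notin\mathcal I(i)$, and $c_{ij}=-c_{ji}$ whenever $i$ or $j$ is not a boundary degree of freedom. The topography is given by real numbers $\mathsf Z_i$. The state at time $t^n$ is $\mathsf U_i^n=(\mathsf H_i^n,\mathsf Q_i^n)^T\in\mathbb R^{d+1}$, $i\in\mathcal V$; $\tau>0$ is the time step. Velocity. With a small parameter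 $\epsilon>0$ and a depth scale $h_{\max}>0$, $\mathsf V_i^n=\frac{2\mathsf H_i^n}{(\mathsf H_i^n)^2+\max(\mathsf H_i^n,\epsilon h_{\max})^2}\mathsf Q_i^n$ (equal to $\mathsf Q_i^n/\mathsf H_i^n$ when $\mathsf H_i^n\ge\epsilon h_{\max}$). Hydrostatic reconstruction. $\mathsf H_i^{*,j}=\max(0,\mathsf H_i^n+\mathsf Z_i-\max(\mathsf Z_i,\mathsf Z_j))$, $\mathsf U_i^{*,j}=(\mathsf H_i^{*,j},\mathsf H_i^{*,j}\mathsf V_i^n)^T$. Graph viscosity. For $j\in\mathcal I^*(i)$, $d_{ij}^{L,n}=\max\big(\lambda_{\max}(\mathsf U_i^{*,j},\mathsf U_j^{*,i},n_{ij})\|c_{ij}\|_{\ell^2},\ \lambda_{\max}(\mathsf U_j^{*,i},\mathsf U_i^{*,j},n_{ji})\|c_{ji}\|_{\ell^2}\big)$, where $n_{ij}=c_{ij}/\|c_{ij}\|_{\ell^2}$ and $\lambda_{\max}(\mathsf U_\ell,\mathsf U_r,n)$ is a guaranteed upper bound on the maximum wave speed in the one-dimensional Riemann problem with left state $\mathsf U_\ell$, right state $\mathsf U_r$ and flux $\mathbb f(\cdot)n$. Also $d_{ii}^{L,n}=-\sum_{j\in\mathcal I^*(i)}d_{ij}^{L,n}$. Low-order update. $\frac{m_i}{\tau}(\mathsf U_i^{L,n+1}-\mathsf U_i^n)=\sum_{j\in\mathcal I(i)}\mathsf F_{ij}^{L,n}$ with $$\mathsf F_{ij}^{L,n}=-\big(\mathsf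 U_j^{*,i}\otimes\mathsf V_j^n+\mathsf U_i^{*,j}\otimes\mathsf V_i^n\big)c_{ij}+d_{ij}^{L,n}(\mathsf U_j^{*,i}-\mathsf U_i^{*,j})-\begin{pmatrix}0\\ g\,c_{ij}\big(\tfrac12(\mathsf H_j^{*,i})^2-\tfrac12(\mathsf H_i^{*,j})^2+(\mathsf H_i^n)^2\big)\end{pmatrix}.$$ Affine shift. $\mathsf B_i^{L,n}=\sum_{j\in\mathcal I(i)}\mathsf B_{ij}^{L,n}$ with $\mathsf B_{ij}^{L,n}=-2(d_{ij}^{L,n}+\mathsf V_i^n\cdot c_{ij})(\mathsf U_i^{*,j}-\mathsf U_i^n)$.
   Formalization: The entropy inequality at i is proved only where the water depth satisfies H_i ≥ ε h_max (in the flat case, H_j ≥ ε h_max for all j in the stencil of i), i.e. where V = Q/H; below this threshold the inequality is false in general. *)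

(* Defs.v *)
From HB Require Import structures.
From mathcomp Require Import all_boot all_order all_algebra.
From mathcomp Require Import all_classical all_reals all_analysis.

Set Implicit Arguments.
Unset Strict Implicit.
Unset Printing Implicit Defensive.

Import Order.TTheory GRing.Theory Num.Theory.
Import numFieldNormedType.Exports.

Local Open Scope classical_set_scope.
Local Open Scope ring_scope.

(* The canonical norm of 'rV[R]_d is the sup norm, hence a separate Euclidean
   norm. *)
Definition dot (R : realType) (d : nat) (x y : 'rV[R]_d) : R :=
  \sum_(k < d) x 0 k * y 0 k.

Definition l2norm (R : realType) (d : nat) (x : 'rV[R]_d) : R :=
  Num.sqrt (dot x x).

(* A state (h, q) is a row vector of R^(1+d): entry 0 is the depth h, the
   remaining d entries are the discharge q. *)
Definition state (R : realType) (d : nat) := 'rV[R]_(1 + d).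

Definition mkstate (R : realType) (d : nat) (h : R) (q : 'rV[R]_d) : state R d :=
  row_mx h%:M q.

Definition depth (R : realType) (d : nat) (u : state R d) : R :=
  (lsubmx u) 0 0.

Definition disch (R : realType) (d : nat) (u : state R d) : 'rV[R]_d :=
  rsubmx u.

Definition wet (R : realType) (d : nat) (u : state R d) : Prop :=
  0 < depth u.

Definition wet_or_vacuum (R : realType) (d : nat) (u : state R d) : Prop :=
  wet u \/ u = 0.

(* Since 0^-1 = 0, this is 0 when h = 0; flux, Eflat and Fflat below then
   vanish at the vacuum state (0, 0). *)
Definition vel (R : realType) (d : nat) (u : state R d) : 'rV[R]_d :=
  (depth u)^-1 *: disch u.

(* f(u)c *)
Definition flux (R : realType) (d : nat) (g : R) (u : state R d)
    (c : 'rV[R]_d) : state R d :=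
  mkstate (dot (disch u) c)
    (dot (vel u) c *: disch u + (2^-1 * g * depth u ^+ 2) *: c).

Definition Eflat (R : realType) (d : nat) (g : R) (u : state R d) : R :=
  2^-1 * g * depth u ^+ 2 + 2^-1 * depth u * l2norm (vel u) ^+ 2.

Definition Fflat (R : realType) (d : nat) (g : R) (u : state R d) : 'rV[R]_d :=
  (Eflat g u + 2^-1 * g * depth u ^+ 2) *: vel u.

Definition grad_Eflat (R : realType) (d : nat) (g : R) (u : state R d) :
    state R d :=
  \row_(k < 1 + d) 'D_(delta_mx 0 k) (@Eflat R d g) u.

(* Self-similar function (x, t) |-> w (x / t), t > 0, with Riemann data
   (ul, ur) at t = 0. *)
Definition selfsim (R : realType) (d : nat) (ul ur : state R d)
    (w : R -> state R d) (x t : R) : state R d :=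
  if t == 0 then (if x < 0 then ul else ur) else w (x / t).

(* w is the profile of a self-similar entropy solution of the Riemann problem
     u_t + (f(u)n)_x = 0,  u(x, 0) = ul if x < 0 and ur if x > 0,
   in the class of bounded functions with bounded velocity (so that vacuum is
   allowed, with q = 0 where h = 0): the conservation law, and the entropy
   inequality E(u)_t + (F(u).n)_x <= 0, are imposed in integral form on every
   space-time rectangle [a, b] x [s, t]. *)
Definition riemann_solution (R : realType) (d : nat) (g : R)
    (ul ur : state R d) (n : 'rV[R]_d) (w : R -> state R d) : Prop :=
  let mu := @lebesgue_measure R in
  let u := selfsim ul ur w in
  [/\ forall k, measurable_fun setT (fun xi => w xi 0 k),
      exists M : R, forall xi,
        0 <= depth (w xi) <= M /\ l2norm (disch (w xi)) <= M * depth (w xi),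
      forall (a b s t : R) (k : 'I_(1 + d)), a < b -> 0 <= s -> s < t ->
        (\int[mu]_(x in `[a, b]) u x t 0 k)
        - (\int[mu]_(x in `[a, b]) u x s 0 k)
        + (\int[mu]_(r in `[s, t]) flux g (u b r) n 0 k)
        - (\int[mu]_(r in `[s, t]) flux g (u a r) n 0 k) = 0
    & forall a b s t : R, a < b -> 0 <= s -> s < t ->
        (\int[mu]_(x in `[a, b]) Eflat g (u x t))
        - (\int[mu]_(x in `[a, b]) Eflat g (u x s))
        + (\int[mu]_(r in `[s, t]) dot (Fflat g (u b r)) n)
        - (\int[mu]_(r in `[s, t]) dot (Fflat g (u a r)) n) <= 0].

(* lam bounds the maximum wave speed of the Riemann problem: its entropy
   solution equals ul for x < - lam t and ur for x > lam t. *)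
Definition wave_speed_bound (R : realType) (d : nat) (g : R)
    (ul ur : state R d) (n : 'rV[R]_d) (lam : R) : Prop :=
  0 <= lam /\
  exists2 w : R -> state R d, riemann_solution g ul ur n w
    & (forall xi, xi < - lam -> w xi = ul) /\ (forall xi, lam < xi -> w xi = ur).

Definition guaranteed_speed (R : realType) (d : nat) (g : R)
    (lmax : state R d -> state R d -> 'rV[R]_d -> R) : Prop :=
  forall (ul ur : state R d) (n : 'rV[R]_d),
    wet_or_vacuum ul -> wet_or_vacuum ur -> l2norm n = 1 ->
    wave_speed_bound g ul ur n (lmax ul ur n).

Record scheme (R : realType) (d N : nat) := Scheme {
  grav : R;
  eps : R;
  hmax : R;
  stencil : 'I_N -> {set 'I_N};
  bdry : {set 'I_N};
  mass : 'I_N -> R;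
  cij : 'I_N -> 'I_N -> 'rV[R]_d;
  topo : 'I_N -> R;
  lmax : state R d -> state R d -> 'rV[R]_d -> R
}.

Definition scheme_ok (R : realType) (d N : nat) (S : scheme R d N) : Prop :=
  [/\ [/\ 0 < grav S, 0 < eps S & 0 < hmax S],
      forall i, i \in stencil S i /\ stencil S i \proper [set: 'I_N]%SET,
      forall i, 0 < mass S i,
      [/\ forall i, \sum_(j in stencil S i) cij S i j = 0,
          forall i j, j \notin stencil S i -> cij S i j = 0
        & forall i j, i \notin bdry S \/ j \notin bdry S ->
            cij S i j = - cij S j i]
    & guaranteed_speed (grav S) (lmax S)].

Section LowOrder.
Variables (R : realType) (d N : nat) (S : scheme R d N).
Variable U : 'I_N -> state R d.

(* Regularized velocity: q_i / h_i when eps hmax <= h_i, and strictly smaller in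
   norm otherwise (if q_i != 0). In the latter case (h_i, h_i Vreg i) <> u_i,
   and the entropy inequality at i fails in general. *)
Definition Vreg (i : 'I_N) : 'rV[R]_d :=
  (2 * depth (U i) /
   (depth (U i) ^+ 2 + Num.max (depth (U i)) (eps S * hmax S) ^+ 2))
    *: disch (U i).

Definition Hstar (i j : 'I_N) : R :=
  Num.max 0 (depth (U i) + topo S i - Num.max (topo S i) (topo S j)).

Definition Ustar (i j : 'I_N) : state R d :=
  mkstate (Hstar i j) (Hstar i j *: Vreg i).

(* Equal to 0 when c_ij = 0; the value is then irrelevant, being multiplied by
   the norm of c_ij in visc_off. *)
Definition nij (i j : 'I_N) : 'rV[R]_d := (l2norm (cij S i j))^-1 *: cij S i j.

Definition visc_off (i j : 'I_N) : R :=
  Num.max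
    (lmax S (Ustar i j) (Ustar j i) (nij i j) * l2norm (cij S i j))
    (lmax S (Ustar j i) (Ustar i j) (nij j i) * l2norm (cij S j i)).

Definition visc (i j : 'I_N) : R :=
  if j == i then - \sum_(k in stencil S i | k != i) visc_off i k
  else visc_off i j.

(* (U (x) V) c is written (V . c) U. *)
Definition Flow (i j : 'I_N) : state R d :=
  - (dot (Vreg j) (cij S i j) *: Ustar j i
     + dot (Vreg i) (cij S i j) *: Ustar i j)
  + visc i j *: (Ustar j i - Ustar i j)
  - mkstate 0
      ((grav S * (2^-1 * Hstar j i ^+ 2 - 2^-1 * Hstar i j ^+ 2
                  + depth (U i) ^+ 2)) *: cij S i j).

Definition Bshift (i : 'I_N) : state R d :=
  \sum_(j in stencil S i)
    (- 2 * (visc i j + dot (Vreg i) (cij S i j))) *: (Ustar i j - U i).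

Definition low_order_update (tau : R) (U1 : 'I_N -> state R d) : Prop :=
  forall i, (mass S i / tau) *: (U1 i - U i) = \sum_(j in stencil S i) Flow i j.

(* tau <= min_i m_i / (2 |d_ii|); a vanishing d_ii imposes no restriction (in
   the library m / 0 = 0, not +oo). *)
Definition cfl (tau : R) : Prop :=
  forall i, visc i i != 0 -> tau <= mass S i / (2 * `|visc i i|).

(* Left-hand side of the entropy inequality at i; W i j is the state at i used
   for the pair (i, j). *)
Definition entropy_lhs (tau : R) (U1 : 'I_N -> state R d)
    (W : 'I_N -> 'I_N -> state R d) (i : 'I_N) : R :=
  mass S i / tau * (Eflat (grav S) (U1 i) - Eflat (grav S) (U i))
  + \sum_(j in stencil S i)
      (dot (Fflat (grav S) (W j i) - Fflat (grav S) (W i j)) (cij S i j)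
       - visc i j * (Eflat (grav S) (W j i) - Eflat (grav S) (W i j))).

End LowOrder.

(* Main.v *)
Require Import Defs.
From HB Require Import structures.
From mathcomp Require Import all_boot all_order all_algebra.
From mathcomp Require Import all_classical all_reals all_analysis measurable_realfun.
From mathcomp Require Import ring lra.
Import Order.TTheory GRing.Theory Num.Theory.
Import numFieldNormedType.Exports.
Local Open Scope classical_set_scope.
Local Open Scope ring_scope.

Set Implicit Arguments.
Unset Strict Implicit.
Unset Printing Implicit Defensive.

(** The entropy is convex as a function of u = (h, q), so everything is tested
    against its affine minorants a + p . u.

    One interface.  Let w be the entropy solution of the Riemann problem with
    data ul, ur in the direction of c, and integrate it at time |c| over the
    interval [-L, L].  If L exceeds lam |c|, no wave has reached the end points,
    so that the conservation law and the entropy inequality on the rectangle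
    [-L, L] x [0, |c|] give
      int w      = L (ul + ur) - (f(ur) - f(ul)) c,
      int E(w)  <= L (E(ul) + E(ur)) - (F(ur) - F(ul)) . c.
    Integrating a + p . w <= E(w) eliminates w: the minorant, applied to the
    first right-hand side, is at most the second one (riemann_fan).  The result
    is affine in L, hence it persists at L = d_ij >= lam |c|
    (interface_entropy).  Up to the factor 2 d_ij this is the entropy inequality
    of the bar state, but no division by d_ij is needed and d_ij = 0 is allowed.

    One node.  Where the depth is at least eps h_max, V_i is the velocity of U_i.
    Since the c_ij sum to zero over the stencil, the fluxes F_ij then sum to B_i
    plus the sum over j <> i of 2 d_ij (bar state - U_i) (sum_Flow).
    Adding the interface inequalities gives low_order_minorant, from which both
    inequalities follow by a choice of the minorant.

    With topography, take the tangent plane of E at U_i.  Reconstruction lowers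
    the depth at constant velocity, so E(U_i^{*,j}) <= E(U_i), and the inequality
    holds for the time derivative of the entropy (semidiscrete_entropy).  As U_i
    is wet, E is smooth there and the forward Euler step changes the entropy by
    tau times this derivative plus O(tau^2) (Eflat_taylor).

    With flat topography, B_i = 0 and U^{n+1}_i is a convex combination of U_i
    and the bar states.  Take a minorant that touches E at U^{n+1}_i itself
    (Eflat_supported); this needs a nonnegative depth there, which follows from
    the minorants u |-> - k h with k arbitrarily large. *)

(** * States, entropy and affine minorants *)

Section Algebra.
Context {R : realType} {d : nat}.
Implicit Types (g a s : R) (x y : 'rV[R]_d) (u v p : state R d).

Lemma dotC n (x y : 'rV[R]_n) : dot x y = dot y x.
Proof. by apply: eq_bigr => k _; rewrite mulrC. Qed.

Lemma dotDr n (x y z : 'rV[R]_n) : dot x (y + z) = dot x y + dot x z.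
Proof. by rewrite -big_split; apply: eq_bigr => k _; rewrite mxE mulrDr. Qed.

Lemma dotZr n a (x y : 'rV[R]_n) : dot x (a *: y) = a * dot x y.
Proof. by rewrite mulr_sumr; apply: eq_bigr => k _; rewrite mxE mulrCA. Qed.

Lemma dotNr n (x y : 'rV[R]_n) : dot x (- y) = - dot x y.
Proof. by rewrite -scaleN1r dotZr mulN1r. Qed.

Lemma dotBr n (x y z : 'rV[R]_n) : dot x (y - z) = dot x y - dot x z.
Proof. by rewrite dotDr dotNr. Qed.

Lemma dot0r n (x : 'rV[R]_n) : dot x 0 = 0.
Proof. by rewrite -(scale0r x) dotZr mul0r. Qed.

Lemma dot_sumr n (x : 'rV[R]_n) I (r : seq I) (P : pred I)
    (f : I -> 'rV[R]_n) :
  dot x (\sum_(i <- r | P i) f i) = \sum_(i <- r | P i) dot x (f i).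
Proof. by apply: (big_morph (dot x)); [exact: dotDr|exact: dot0r]. Qed.

Lemma dotDl n (x y z : 'rV[R]_n) : dot (x + y) z = dot x z + dot y z.
Proof. by rewrite dotC dotDr !(dotC z). Qed.

Lemma dotZl n a (x y : 'rV[R]_n) : dot (a *: x) y = a * dot x y.
Proof. by rewrite dotC dotZr dotC. Qed.

Lemma dotNl n (x y : 'rV[R]_n) : dot (- x) y = - dot x y.
Proof. by rewrite dotC dotNr dotC. Qed.

Lemma dotBl n (x y z : 'rV[R]_n) : dot (x - y) z = dot x z - dot y z.
Proof. by rewrite dotDl dotNl. Qed.

Lemma dot0l n (x : 'rV[R]_n) : dot 0 x = 0.
Proof. by rewrite dotC dot0r. Qed.

Lemma dot_delta n (x : 'rV[R]_n) k : dot x (delta_mx 0 k) = x 0 k.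
Proof.
rewrite /dot (bigD1 k) //= big1 => [|j /negPf jk]; rewrite mxE eqxx ?jk.
  by rewrite eqxx mulr1 addr0.
by rewrite mulr0.
Qed.

Lemma dotxx_ge0 n (x : 'rV[R]_n) : 0 <= dot x x.
Proof. by apply: sumr_ge0 => k _; rewrite -expr2 sqr_ge0. Qed.

Lemma l2norm_sq n (x : 'rV[R]_n) : l2norm x ^+ 2 = dot x x.
Proof. by rewrite /l2norm sqr_sqrtr // dotxx_ge0. Qed.

Lemma ler_l2norm n (x : 'rV[R]_n) k : `|x 0 k| <= l2norm x.
Proof.
rewrite -sqrtr_sqr ler_sqrt ?dotxx_ge0 // /dot (bigD1 k) //= expr2 lerDl.
by apply: sumr_ge0 => j _; rewrite -expr2 sqr_ge0.
Qed.

Lemma l2norm_le0 n (x : 'rV[R]_n) : l2norm x <= 0 -> x = 0.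
Proof.
move=> x0; apply/rowP => k; rewrite mxE; apply/eqP.
by rewrite -normr_le0 (le_trans (ler_l2norm _ _)).
Qed.

Lemma l2norm_ge0 n (x : 'rV[R]_n) : 0 <= l2norm x.
Proof. exact: sqrtr_ge0. Qed.

Lemma l2normZ n a (x : 'rV[R]_n) : l2norm (a *: x) = `|a| * l2norm x.
Proof.
by rewrite /l2norm dotZl dotZr mulrA -expr2 sqrtrM ?sqr_ge0 // sqrtr_sqr.
Qed.

Lemma depthE u : depth u = u 0 (lshift d 0).
Proof. by rewrite /depth mxE. Qed.

Lemma dischE u k : disch u 0 k = u 0 (rshift 1 k).
Proof. by rewrite /disch mxE. Qed.

Lemma depth_mk h x : depth (mkstate h x) = h.
Proof. by rewrite /depth /mkstate row_mxKl mxE eqxx mulr1n. Qed.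

Lemma disch_mk (h : R) x : disch (mkstate h x) = x.
Proof. by rewrite /disch /mkstate row_mxKr. Qed.

Lemma state_eq u v : depth u = depth v -> disch u = disch v -> u = v.
Proof.
move=> huv quv; rewrite -(hsubmxK u) -(hsubmxK v) -/(disch u) -/(disch v) quv.
by congr row_mx; apply/matrixP => i j; rewrite !ord1.
Qed.

Lemma depthD u v : depth (u + v) = depth u + depth v.
Proof. by rewrite !depthE mxE. Qed.
Lemma depthZ a u : depth (a *: u) = a * depth u.
Proof. by rewrite !depthE mxE. Qed.
Lemma depthN u : depth (- u) = - depth u.
Proof. by rewrite !depthE mxE. Qed.
Lemma depth0 : depth (0 : state R d) = 0.
Proof. by rewrite !depthE mxE. Qed.
Lemma dischD u v : disch (u + v) = disch u + disch v.
Proof. exact: linearD. Qed.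
Lemma dischZ a u : disch (a *: u) = a *: disch u.
Proof. exact: linearZ. Qed.
Lemma dischN u : disch (- u) = - disch u.
Proof. exact: linearN. Qed.
Lemma disch0 : disch (0 : state R d) = 0.
Proof. exact: linear0. Qed.

Lemma dot_state p u :
  dot p u = depth p * depth u + dot (disch p) (disch u).
Proof.
rewrite {1}/dot big_split_ord /= big_ord1 !depthE; congr (_ + _).
by apply: eq_bigr => k _; rewrite !dischE.
Qed.

(** The states on which the entropy is the convex function
    g h^2 / 2 + |q|^2 / (2 h); in particular q = h (vel u) holds there. *)
Definition admissible u := 0 <= depth u /\ (depth u = 0 -> disch u = 0).

Lemma wet_or_vacuum_admissible u : wet_or_vacuum u -> admissible u.
Proof.
move=> [hu|->]; last by rewrite /admissible depth0 disch0.
by split; [exact: ltW|move=> h0; move: hu; rewrite /wet h0 ltxx].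
Qed.

Lemma disch_vel u : admissible u -> disch u = depth u *: vel u.
Proof.
move=> [_ u0]; rewrite /vel scalerA; have [h0|h0] := eqVneq (depth u) 0.
  by rewrite u0 // scaler0.
by rewrite divff // scale1r.
Qed.

Lemma EflatE g u : Eflat g u =
  2^-1 * g * depth u ^+ 2 + 2^-1 * depth u * dot (vel u) (vel u).
Proof. by rewrite /Eflat l2norm_sq. Qed.

Lemma Eflat_ge0 g u : 0 <= g -> 0 <= depth u -> 0 <= Eflat g u.
Proof.
move=> g0 h0; rewrite EflatE addr_ge0 // !mulr_ge0 ?invr_ge0 ?sqr_ge0 //.
exact: dotxx_ge0.
Qed.

Lemma Eflat_dry g u : depth u = 0 -> Eflat g u = 0.
Proof. by move=> h0; rewrite EflatE h0 expr0n /= mulr0 add0r mulr0 mul0r. Qed.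

(** The gradient of the entropy at a wet state, see grad_EflatE; it is 0 at
    vacuum, where the entropy is not differentiable. *)
Definition entropy_var g u : state R d :=
  mkstate (g * depth u - 2^-1 * dot (vel u) (vel u)) (vel u).

(** In the variables (h, v) the remainder of the tangent expansion is an explicit
    sum of squares; its sign is the convexity of the entropy. *)
Lemma Eflat_bregman g u v : admissible u -> admissible v ->
  Eflat g v = Eflat g u + dot (entropy_var g u) (v - u)
    + (2^-1 * g * (depth v - depth u) ^+ 2
       + 2^-1 * depth v * dot (vel v - vel u) (vel v - vel u)).
Proof.
move=> /disch_vel qu /disch_vel qv.
rewrite !EflatE dot_state depth_mk disch_mk depthD depthN dischD dischN qu qv.
move: (vel u) (vel v) => x y.
by rewrite !(dotBr, dotBl, dotZr) (dotC y x); field.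
Qed.

Definition entropy_minorant g a p :=
  forall u, admissible u -> a + dot p u <= Eflat g u.

Lemma tangent_minorant g u : 0 <= g -> admissible u ->
  entropy_minorant g (Eflat g u - dot (entropy_var g u) u) (entropy_var g u).
Proof.
move=> g0 hu v hv; rewrite (Eflat_bregman g hu hv) dotBr.
have [h0 _] := hv.
set r := (X in _ <= _ + X); suff : 0 <= r by lra.
apply: addr_ge0; apply: mulr_ge0; rewrite ?sqr_ge0 ?dotxx_ge0 //;
  by rewrite mulr_ge0 ?invr_ge0.
Qed.

(** At depth 0 the convention 0^-1 = 0 makes the entropy vanish for every q, so
    the zero functional touches it there. *)
Lemma Eflat_supported g u : 0 <= g -> 0 <= depth u ->
  exists a p, entropy_minorant g a p /\ Eflat g u = a + dot p u.
Proof.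
move=> g0; rewrite le_eqVlt => /predU1P[h0|h0].
  exists 0, 0; split; last by rewrite dot0l addr0 Eflat_dry.
  by move=> v [hv _]; rewrite dot0l addr0 Eflat_ge0.
have hu : admissible u by apply: wet_or_vacuum_admissible; left.
exists (Eflat g u - dot (entropy_var g u) u), (entropy_var g u).
by rewrite subrK; split=> //; exact: tangent_minorant.
Qed.

(** As k is arbitrary, an upper bound on all minorants at a point forces the
    depth to be nonnegative there. *)
Lemma depth_minorant g k : 0 <= g -> 0 <= k ->
  entropy_minorant g 0 (mkstate (- k) 0).
Proof.
move=> g0 k0 u [h0 _]; rewrite dot_state depth_mk disch_mk dot0l addr0 add0r.
by rewrite (le_trans _ (Eflat_ge0 g0 h0)) // mulNr oppr_le0 mulr_ge0.
Qed.

(** The remainder is exactly quadratic in s apart from the depth in the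
    denominator, because q - h (vel u) is linear along the line and vanishes at
    s = 0. *)
Lemma Eflat_line g u v s : wet u -> wet (u + s *: v) ->
  let D := disch v - depth v *: vel u in
  Eflat g (u + s *: v) = Eflat g u + s * dot (entropy_var g u) v
    + s ^+ 2 * (2^-1 * g * depth v ^+ 2 + 2^-1 * dot D D / depth (u + s *: v)).
Proof.
move=> hu hv D; set w := u + _ in hv *.
have aw : admissible w by apply: wet_or_vacuum_admissible; left.
have au : admissible u by apply: wet_or_vacuum_admissible; left.
have hw0 : depth w != 0 by rewrite gt_eqF.
have DE : s *: D = depth w *: (vel w - vel u).
  rewrite [RHS]scalerBr -(disch_vel aw) /D /w depthD depthZ dischD dischZ (disch_vel au).
  by move: (vel u) (disch v) => x q; apply/rowP => k; rewrite !mxE; ring.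
have wv : vel w - vel u = (s / depth w) *: D.
  by rewrite mulrC -scalerA DE scalerA mulVf // scale1r.
rewrite (Eflat_bregman g au aw) wv dotZl dotZr.
have -> : w - u = s *: v by rewrite /w addrC addKr.
have -> : depth w - depth u = s * depth v.
  by rewrite /w depthD depthZ addrC addKr.
by rewrite dotZr; field.
Qed.

End Algebra.

(** * Averaging a minorant over a Riemann fan *)

Section RiemannFan.
Context {R : realType} {d : nat}.
Local Notation mu := (@lebesgue_measure R).
Implicit Types (g a s t L M lam : R) (u v p : state R d).

Lemma bounded_integrable_itv (f : R -> R) M a s : measurable_fun setT f ->
  (forall x, `|f x| <= M) -> mu.-integrable `[a, s] (EFin \o f).
Proof.
move=> mf fM; apply: measurable_bounded_integrable => //.
- rewrite /= lebesgue_measure_itv /=.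
  by case: ifPn => // _; rewrite -EFinB ltry.
- exact: measurable_funS mf.
- by exists M; split; rewrite ?num_real // => x Mx y _ /=; rewrite (le_trans _ (ltW Mx)).
Qed.

Lemma Rintegral_itv_cst (c : R) a s : a <= s ->
  \int[mu]_(x in `[a, s]) c = c * (s - a).
Proof.
move=> as_; rewrite Rintegral_cst //= lebesgue_measure_itv /= lte_fin.
by case: ltgtP as_ => //= ->; rewrite subrr.
Qed.

(** The mass of the Riemann data on the interval [-L, L]. *)
Lemma Rintegral_step (b c : R) L : 0 < L ->
  \int[mu]_(x in `[- L, L]) (if x < 0 then b else c) = L * (b + c).
Proof.
move=> L0; pose f (x : R) := if x < 0 then b else c; rewrite -/f.
have fi a s : mu.-integrable `[a, s] (EFin \o f).
  apply: (@bounded_integrable_itv _ (`|b| + `|c|)).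
    by apply: measurable_fun_ifT => //; exact: measurable_fun_ltr.
  by move=> x; rewrite /f; case: ifP => _; rewrite ?lerDl ?lerDr.
have NL0 : - L <= 0 by rewrite oppr_le0 ltW.
rewrite (@itv_bndbnd_setU _ _ _ (BLeft 0)) ?bnd_simp ?(ltW L0) //.
rewrite Rintegral_setU //=; last 2 first.
- rewrite -itv_bndbnd_setU ?bnd_simp ?(ltW L0) //.
- apply: lt_disjoint => x y; rewrite !in_itv /= => /andP[_ x0] /andP[y0 _].
  exact: lt_le_trans y0.
rewrite [X in _ + X](@eq_Rintegral _ _ _ _ _ (fun=> c)); last first.
  by move=> x; rewrite inE /= in_itv /f /= => /andP[x0 _]; rewrite ltNge x0.
rewrite [X in _ + X]Rintegral_itv_cst ?(ltW L0) //.
rewrite (@eq_Rintegral _ _ _ _ _ (fun=> b)); last first.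
  by move=> x; rewrite inE /= in_itv /f /= => /andP[_ x0]; rewrite x0.
rewrite Rintegral_itv_bndo_bndc; last first.
  apply: (integrableS _ _ _ (@bounded_integrable_itv (fun=> b) `|b| (- L) 0 _ _)) => //.
  by apply: subset_itvl; rewrite bnd_simp.
by rewrite Rintegral_itv_cst //; ring.
Qed.

Lemma Rintegral_dot n (p : 'rV[R]_n) (W : R -> 'rV[R]_n) a s :
  (forall k, mu.-integrable `[a, s] (EFin \o fun x => W x 0 k)) ->
  mu.-integrable `[a, s] (EFin \o fun x => dot p (W x)) /\
  \int[mu]_(x in `[a, s]) dot p (W x)
  = \sum_(k < n) p 0 k * \int[mu]_(x in `[a, s]) W x 0 k.
Proof.
move=> Wi; rewrite /dot; elim: (index_enum _) => [|k r [IHi IH]].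
  have -> : (fun x => \sum_(k <- [::]) p 0 k * W x 0 k) = fun=> 0.
    by apply/funext => x; rewrite big_nil.
  rewrite big_nil /Rintegral integral0; split=> //.
  by apply: (@bounded_integrable_itv _ 0) => // x; rewrite normr0.
have -> : (fun x => \sum_(i <- k :: r) p 0 i * W x 0 i) =
    (fun x => p 0 k * W x 0 k + \sum_(i <- r) p 0 i * W x 0 i).
  by apply/funext => x; rewrite big_cons.
have ki : mu.-integrable `[a, s] (EFin \o fun x => p 0 k * W x 0 k).
  exact: (integrableZl _ (p 0 k) (Wi k)).
rewrite big_cons RintegralD // RintegralZl // IH; split=> //.
exact: (integrableD _ ki IHi).
Qed.

Section BoundedProfile.
Variables (W : R -> state R d) (M : R).
Hypothesis mW : forall k, measurable_fun setT (fun x => W x 0 k).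
Hypothesis bW : forall x, 0 <= depth (W x) <= M /\
  l2norm (disch (W x)) <= M * depth (W x).

Lemma profile_admissible x : admissible (W x).
Proof.
have [/andP[h0 _] qh] := bW x; split=> // h00.
by apply: l2norm_le0; rewrite (le_trans qh) // h00 mulr0.
Qed.

Lemma profile_integrable a s k :
  mu.-integrable `[a, s] (EFin \o fun x => W x 0 k).
Proof.
apply: (@bounded_integrable_itv _ (M + M * M)) => // x.
have [/andP[h0 hM] qh] := bW x; have M0 := le_trans h0 hM.
case: (split_ordP k) => j ->.
  by rewrite ord1 -depthE ger0_norm // (le_trans hM) // lerDl mulr_ge0.
rewrite -dischE (le_trans (ler_l2norm _ _)) // (le_trans qh) //.
by rewrite (le_trans (ler_wpM2l M0 hM)) // lerDr.
Qed.

(** Bounded velocity keeps the kinetic energy bounded up to vacuum. *)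
Lemma profile_Eflat_integrable g a s : 0 <= g ->
  mu.-integrable `[a, s] (EFin \o fun x => Eflat g (W x)).
Proof.
move=> g0; apply: (@bounded_integrable_itv _ (2^-1 * g * M ^+ 2 + 2^-1 * M * M ^+ 2)).
  have mh : measurable_fun setT (fun x => depth (W x)).
    by under eq_fun do rewrite depthE; exact: mW.
  under eq_fun do rewrite EflatE.
  apply: measurable_funD.
    by apply: measurable_funM => //; exact: measurable_funX.
  apply: measurable_funM; first exact: measurable_funM.
  apply: measurable_sum => k; rewrite -/(_ * _).
  suff mv : measurable_fun setT (fun x => vel (W x) 0 k) by exact: measurable_funM.
  (* The power -1 is measurable on the whole line and is the inverse at
     nonnegative arguments. *)
  have -> : (fun x => vel (W x) 0 k) =
      (fun x => depth (W x) `^ (- 1) * W x 0 (rshift 1 k)).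
    apply/funext => x; rewrite /vel mxE dischE powR_inv1 //.
    by have [/andP[]] := bW x.
  apply: measurable_funM => //.
  exact: (measurableT_comp (measurable_powR (- 1)) mh).
move=> x; have [/andP[h0 hM] qh] := bW x; have M0 := le_trans h0 hM.
rewrite ger0_norm ?Eflat_ge0 // /Eflat lerD //.
  by rewrite ler_wpM2l ?mulr_ge0 ?invr_ge0 // ler_pXn2r.
have vM : l2norm (vel (W x)) <= M.
  rewrite /vel l2normZ ger0_norm ?invr_ge0 //.
  move: h0; rewrite le_eqVlt => /predU1P[<-|h0]; first by rewrite invr0 mul0r.
  by rewrite mulrC ler_pdivrMr.
apply: ler_pM; rewrite ?mulr_ge0 ?invr_ge0 ?exprn_ge0 ?l2norm_ge0 //.
  by rewrite ler_wpM2l ?invr_ge0.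
by rewrite ler_pXn2r // nnegrE ?l2norm_ge0.
Qed.

End BoundedProfile.

(** The strict inequality lam t < L keeps the end points -L and L outside the fan
    during the whole interval [0, t], so that the boundary fluxes are exactly
    those of ul and ur. *)
Lemma riemann_fan g ul ur (n : 'rV[R]_d) w lam L t a p : 0 <= g ->
  riemann_solution g ul ur n w ->
  (forall xi, xi < - lam -> w xi = ul) -> (forall xi, lam < xi -> w xi = ur) ->
  0 <= lam -> 0 < t -> lam * t < L -> entropy_minorant g a p ->
  2 * L * a + dot p (L *: (ul + ur) - t *: (flux g ur n - flux g ul n))
  <= L * (Eflat g ul + Eflat g ur) - t * dot (Fflat g ur - Fflat g ul) n.
Proof.
move=> g0 [mw [M bw] cons entr] wl wr lam0 t0 lamtL mino.
have L0 : 0 < L by rewrite (le_lt_trans _ lamtL) // mulr_ge0 // ltW.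
have NLL : - L < L by rewrite gtrN.
set u := selfsim ul ur w.
have left r : r \in `[0, t] -> u (- L) r = ul.
  rewrite in_itv /u /selfsim => /andP[r0 rt]; rewrite oppr_lt0 L0.
  case: eqP => // /eqP rn0; apply: wl; have r1 : 0 < r by rewrite lt_def rn0.
  rewrite mulNr ltrN2 ltr_pdivlMr // (le_lt_trans _ lamtL) //.
  by rewrite ler_wpM2l.
have right r : r \in `[0, t] -> u L r = ur.
  rewrite in_itv /u /selfsim => /andP[r0 rt]; rewrite ltNge (ltW L0).
  case: eqP => // /eqP rn0; apply: wr; have r1 : 0 < r by rewrite lt_def rn0.
  rewrite ltr_pdivlMr // (le_lt_trans _ lamtL) //.
  by rewrite ler_wpM2l.
have initial (phi : state R d -> R) :
    \int[mu]_(x in `[- L, L]) phi (u x 0) = L * (phi ul + phi ur).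
  rewrite -Rintegral_step //; apply: eq_Rintegral => x _.
  by rewrite /u /selfsim eqxx; case: ifP.
have sides (phi : state R d -> R) v x : (forall r, r \in `[0, t] -> u x r = v) ->
    \int[mu]_(r in `[0, t]) phi (u x r) = t * phi v.
  move=> uv; rewrite (@eq_Rintegral _ _ _ _ _ (fun=> phi v)).
    by rewrite Rintegral_itv_cst ?(ltW t0) // subr0 mulrC.
  by move=> r; rewrite inE /= => rt; rewrite uv.
pose W x := u x t.
have WE x : W x = w (x / t) by rewrite /W /u /selfsim gt_eqF.
have mW k : measurable_fun setT (fun x => W x 0 k).
  under eq_fun do rewrite WE.
  by apply: (measurableT_comp (mw k)); exact: measurable_funM.
have bW x : 0 <= depth (W x) <= M /\ l2norm (disch (W x)) <= M * depth (W x).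
  by rewrite WE.
have consW k : \int[mu]_(x in `[- L, L]) W x 0 k =
    (L *: (ul + ur) - t *: (flux g ur n - flux g ul n)) 0 k.
  have := cons (- L) L 0 t k NLL (lexx _) t0; rewrite -/u.
  rewrite (initial (fun v => v 0 k)) (sides (fun v => flux g v n 0 k) _ _ right).
  rewrite (sides (fun v => flux g v n 0 k) _ _ left) !mxE -/(W _) => /eqP.
  rewrite -/mu; set I := Rintegral _ _ _.
  by rewrite subr_eq0 => /eqP; lra.
have := entr (- L) L 0 t NLL (lexx _) t0; rewrite -/u.
rewrite (initial (Eflat g)) (sides (fun v => dot (Fflat g v) n) _ _ right).
rewrite (sides (fun v => dot (Fflat g v) n) _ _ left) => entW.
have [pi pE] := @Rintegral_dot _ p W (- L) L (profile_integrable mW bW _ _).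
have ci : mu.-integrable `[- L, L] (EFin \o fun=> a).
  exact: (@bounded_integrable_itv _ `|a|).
have : \int[mu]_(x in `[- L, L]) (a + dot p (W x))
    <= \int[mu]_(x in `[- L, L]) Eflat g (W x).
  apply: le_Rintegral => //.
  - exact: (integrableD _ ci pi).
  - exact: profile_Eflat_integrable bW _ _ _ _.
  - by move=> x _; apply: mino; exact: profile_admissible bW x.
rewrite RintegralD // pE Rintegral_itv_cst ?(ltW NLL) //.
under eq_bigr do rewrite consW.
rewrite -/(dot _ _) => minW; rewrite dotBl.
move: entW minW; rewrite /W; set I := Rintegral _ _ _; lra.
Qed.

End RiemannFan.

(** * One interface, and smoothness of the entropy at wet states *)

Section Interface.
Context {R : realType} {d : nat}.
Implicit Types (g a s : R) (u v p ul ur : state R d) (c : 'rV[R]_d).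

Lemma ler_affine_right (A B x0 : R) :
  (forall x, x0 < x -> A + x * B <= 0) -> A + x0 * B <= 0.
Proof.
move=> AB; apply/ler_addgt0Pr => e e0; rewrite add0r.
have B1 : 0 < `|B| + 1 by rewrite ltr_wpDl.
have := AB (x0 + e / (`|B| + 1)); rewrite ltrDl divr_gt0 // => /(_ isT).
have : - (e / (`|B| + 1) * B) <= e.
  rewrite -mulrN -mulrA ler_piMr ?(ltW e0) // mulrC ler_pdivrMr // mul1r.
  by rewrite (le_trans (ler_norm _)) // normrN lerDl.
lra.
Qed.

Lemma fluxZ g u k c : flux g u (k *: c) = k *: flux g u c.
Proof.
apply: state_eq; rewrite ?depthZ ?dischZ ?depth_mk ?disch_mk ?dotZr //.
by rewrite scalerDr !scalerA; congr (_ *: _ + _ *: _); ring.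
Qed.

Lemma flux0 g u : flux g u 0 = 0.
Proof. by rewrite -(scale0r 0) fluxZ scale0r. Qed.

(** Twice D times the entropy inequality of the bar state
    (ul + ur) / 2 - (f(ur) - f(ul)) c / (2 D), tested against a minorant.  When
    c = 0 the bar state is the midpoint, and no Riemann problem is involved. *)
Lemma interface_entropy g ul ur c lam D a p : 0 <= g ->
  admissible ul -> admissible ur ->
  (c != 0 -> wave_speed_bound g ul ur ((l2norm c)^-1 *: c) lam) ->
  lam * l2norm c <= D -> 0 <= D -> entropy_minorant g a p ->
  2 * D * a + dot p (D *: (ul + ur) - (flux g ur c - flux g ul c))
  <= D * (Eflat g ul + Eflat g ur) - dot (Fflat g ur - Fflat g ul) c.
Proof.
move=> g0 al ar; have [-> _ _ D0 mino|c0] := eqVneq c 0.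
  rewrite dot0r !flux0 !subr0 dotZr dotDr.
  have := ler_wpM2l D0 (lerD (mino _ al) (mino _ ar)); lra.
move=> /(_ isT) [lam0 [w sol [wl wr]]] lamD D0 mino.
have c1 : 0 < l2norm c.
  rewrite lt_def l2norm_ge0 andbT; apply: contra_neq c0 => c0.
  by apply: l2norm_le0; rewrite c0.
set n := _ *: c in sol; have cE : c = l2norm c *: n.
  by rewrite scalerA divff ?gt_eqF // scale1r.
have fE u : flux g u c = l2norm c *: flux g u n by rewrite {1}cE fluxZ.
have FE x : dot x c = l2norm c * dot x n by rewrite {1}cE dotZr.
suff : (dot p (- (flux g ur c - flux g ul c)) + dot (Fflat g ur - Fflat g ul) c)
    + D * (2 * a + dot p (ul + ur) - (Eflat g ul + Eflat g ur)) <= 0.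
  rewrite dotBr dotNr dotZr; lra.
(* Time |c| and half-width L > D >= lam |c|, in the direction n = c / |c|. *)
apply: ler_affine_right => L DL.
have := riemann_fan g0 sol wl wr lam0 c1 (le_lt_trans lamD DL) mino.
rewrite !fE FE -scalerBr !dotBr !dotNr !dotZr; lra.
Qed.

Lemma Eflat_taylor g u v : 0 <= g -> wet u ->
  exists C e : R, [/\ 0 <= C, 0 < e & forall s, `|s| < e ->
    `|Eflat g (u + s *: v) - Eflat g u - s * dot (entropy_var g u) v|
    <= C * s ^+ 2].
Proof.
move=> g0 hu; pose D := disch v - depth v *: vel u.
have v1 : 0 < `|depth v| + 1 by rewrite ltr_wpDl.
exists (2^-1 * g * depth v ^+ 2 + dot D D / depth u).
(* This radius keeps the depth above half its initial value. *)
exists (depth u / 2 / (`|depth v| + 1)); split.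
- apply: addr_ge0; last by rewrite divr_ge0 ?dotxx_ge0 ?(ltW hu).
  by rewrite mulr_ge0 ?sqr_ge0 // mulr_ge0 ?invr_ge0.
- by rewrite !divr_gt0.
move=> s; rewrite ltr_pdivlMr // => se.
have hw : depth u / 2 <= depth (u + s *: v).
  rewrite depthD depthZ; have : `|s * depth v| <= depth u / 2.
    by rewrite normrM (le_trans _ (ltW se)) // ler_wpM2l // lerDl.
  by rewrite ler_norml => /andP[]; lra.
have ww : wet (u + s *: v) by rewrite /wet (lt_le_trans _ hw) // divr_gt0.
rewrite (Eflat_line g hu ww) -/D; set K := (X in s ^+ 2 * X).
have -> : Eflat g u + s * dot (entropy_var g u) v + s ^+ 2 * K - Eflat g u
    - s * dot (entropy_var g u) v = s ^+ 2 * K by ring.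
have K0 : 0 <= K.
  apply: addr_ge0; first by rewrite mulr_ge0 ?sqr_ge0 // mulr_ge0 ?invr_ge0.
  by rewrite divr_ge0 ?(ltW ww) // mulr_ge0 ?dotxx_ge0 ?invr_ge0.
rewrite ger0_norm; last exact: mulr_ge0 (sqr_ge0 s) K0.
rewrite mulrC ler_wpM2r ?sqr_ge0 // lerD //.
rewrite ler_pdivrMr // [leRHS]mulrAC ler_pdivlMr //.
have := ler_wpM2l (dotxx_ge0 D) hw; lra.
Qed.

Lemma grad_EflatE g u : 0 <= g -> wet u -> grad_Eflat g u = entropy_var g u.
Proof.
move=> g0 hu; apply/rowP => k; rewrite mxE -dot_delta; set v := delta_mx 0 k.
have [C [e [C0 e0 Ce]]] := Eflat_taylor v g0 hu.
apply: cvg_lim => //; apply/cvgrPdist_le => r r0.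
have C1 : 0 < C + 1 by rewrite ltr_wpDl.
near=> s.
have s0 : s != 0 by near: s; exact: nbhs_dnbhs_neq.
have se : `|s| < e.
  near: s; apply: dnbhs0_lt => //.
have sr : `|s| < r / (C + 1).
  by near: s; apply: dnbhs0_lt; rewrite divr_gt0.
rewrite distrC /= (addrC (s *: v)).
have -> : s^-1 *: (Eflat g (u + s *: v) - Eflat g u) - dot (entropy_var g u) v =
   s^-1 * (Eflat g (u + s *: v) - Eflat g u - s * dot (entropy_var g u) v).
  by rewrite /GRing.scale /=; field.
rewrite normrM normfV mulrC ler_pdivrMr ?normr_gt0 //.
rewrite (le_trans (Ce _ se)) // -[s ^+ 2]real_normK ?num_real //.
rewrite expr2 mulrA ler_wpM2r //.
move: sr; rewrite ltr_pdivlMr // mulrDr mulr1 => sr.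
have := normr_ge0 s; lra.
Unshelve. all: by end_near. Qed.

End Interface.

(** * The low-order scheme at one node *)

Section Scheme.
Context {R : realType} {d N : nat} (S : scheme R d N) (U : 'I_N -> state R d).
Hypothesis hS : scheme_ok S.
Hypothesis hU : forall i, wet (U i).
Local Notation g := (grav S).
Local Notation c := (cij S).
Local Notation H := (Hstar S U).
Local Notation V := (Vreg S U).
Local Notation Us := (Ustar S U).
Local Notation dv := (visc_off S U).
Local Notation E := (Eflat (grav S)).
Local Notation F := (Fflat (grav S)).

Lemma grav_ge0 : 0 <= g.
Proof. by case: hS => -[/ltW]. Qed.

Lemma sum_cij i : \sum_(j in stencil S i) c i j = 0.
Proof. by case: hS => _ _ _ [/(_ i)]. Qed.

Lemma Hstar_ge0 i j : 0 <= H i j.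
Proof. by rewrite /Hstar le_max lexx. Qed.

Lemma Hstar_le_depth i j : H i j <= depth (U i).
Proof.
rewrite /Hstar ge_max (ltW (hU i)) /= lerBlDr lerD2l le_max lexx //.
Qed.

Lemma Hstar_flat i j : topo S i = topo S j -> H i j = depth (U i).
Proof.
move=> ij; rewrite /Hstar -ij maxxx addrK.
by apply/max_idPr; exact: ltW (hU i).
Qed.

Lemma Ustar_wet_or_vacuum i j : wet_or_vacuum (Us i j).
Proof.
rewrite /wet_or_vacuum /wet depth_mk; have := Hstar_ge0 i j.
rewrite le_eqVlt => /predU1P[h0|]; [right|by left].
by apply: state_eq; rewrite ?depth_mk ?disch_mk ?depth0 ?disch0 -h0 ?scale0r.
Qed.

Lemma Ustar_admissible i j : admissible (Us i j).
Proof. exact/wet_or_vacuum_admissible/Ustar_wet_or_vacuum. Qed.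

Lemma Vreg_vel i : eps S * hmax S <= depth (U i) -> V i = vel (U i).
Proof.
move=> /max_idPl hi; rewrite /Vreg /vel hi; congr (_ *: _); field.
have h0 : 0 < depth (U i) := hU i.
by rewrite !gt_eqF // addr_gt0 // exprn_gt0.
Qed.

Lemma Ustar_flat i j : eps S * hmax S <= depth (U i) ->
  topo S i = topo S j -> Us i j = U i.
Proof.
move=> hi ij; have h0 := hU i.
rewrite /Ustar Hstar_flat // Vreg_vel //.
apply: state_eq; rewrite ?depth_mk ?disch_mk // -disch_vel //.
by apply: wet_or_vacuum_admissible; left.
Qed.

Lemma Eflat_Ustar i j :
  E (Us i j) = 2^-1 * g * H i j ^+ 2 + 2^-1 * H i j * dot (V i) (V i).
Proof.
rewrite EflatE /vel depth_mk disch_mk; have [->|h0] := eqVneq (H i j) 0.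
  by rewrite !(mulr0, mul0r).
by rewrite scalerA mulVf // scale1r.
Qed.

(** The reconstruction keeps the velocity and lowers the depth, in which the
    entropy is then monotone. *)
Lemma Eflat_Ustar_le i j : eps S * hmax S <= depth (U i) -> E (Us i j) <= E (U i).
Proof.
move=> hi; rewrite -[in leRHS](@Ustar_flat i i) // !Eflat_Ustar (@Hstar_flat i i) //.
have hH := Hstar_le_depth i j; have H0 := Hstar_ge0 i j.
apply: lerD; last by rewrite ler_wpM2r ?dotxx_ge0 // ler_wpM2l ?invr_ge0.
rewrite ler_wpM2l ?mulr_ge0 ?invr_ge0 ?grav_ge0 //.
by rewrite ler_pXn2r ?nnegrE ?(ltW (hU i)).
Qed.

(** The transport term of the scheme together with its share of the pressure is
    a physical flux, also at vacuum. *)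
Lemma flux_Ustar i j x :
  flux g (Us i j) x
  = dot (V i) x *: Us i j + mkstate 0 ((2^-1 * g * H i j ^+ 2) *: x).
Proof.
apply: state_eq; rewrite ?depthD ?dischD ?depthZ ?dischZ ?depth_mk ?disch_mk.
  by rewrite addr0 dotZl mulrC.
rewrite /vel /Ustar !depth_mk disch_mk; congr (_ + _).
have [->|h0] := eqVneq (H i j) 0; first by rewrite scale0r !scaler0.
by rewrite [_^-1 *: _]scalerA mulVf // scale1r.
Qed.

(** A bound on the wave speed is only available for a nonzero c_ij, since the
    direction must be a unit vector; for c_ij = 0 the viscosity is still
    nonnegative, its first argument being 0. *)
Lemma visc_off_speed i j :
  0 <= dv i j /\ exists lam, lam * l2norm (c i j) <= dv i j /\
    (c i j != 0 -> wave_speed_bound g (Us i j) (Us j i) (nij S i j) lam).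
Proof.
set lam := lmax S (Us i j) (Us j i) (nij S i j).
have lamd : lam * l2norm (c i j) <= dv i j by rewrite le_max lexx.
have speed : c i j != 0 -> wave_speed_bound g (Us i j) (Us j i) (nij S i j) lam.
  move=> c0; case: hS => _ _ _ _; apply; try exact: Ustar_wet_or_vacuum.
  rewrite /nij l2normZ ger0_norm ?invr_ge0 ?l2norm_ge0 // mulVf //.
  by apply: contra_neq c0 => c0; apply: l2norm_le0; rewrite c0.
split; last by exists lam.
apply: le_trans lamd; have [->|c0] := eqVneq (c i j) 0.
  by rewrite /l2norm dot0l sqrtr0 mulr0.
by rewrite mulr_ge0 ?l2norm_ge0 //; case: (speed c0).
Qed.

Lemma visc_off_ge0 i j : 0 <= dv i j.
Proof. by case: (visc_off_speed i j). Qed.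

Lemma interface_entropy_Ustar i j a p : entropy_minorant g a p ->
  2 * dv i j * a + dot p (dv i j *: (Us i j + Us j i)
    - (flux g (Us j i) (c i j) - flux g (Us i j) (c i j)))
  <= dv i j * (E (Us i j) + E (Us j i))
     - dot (F (Us j i) - F (Us i j)) (c i j).
Proof.
have [d0 [lam [lamd speed]]] := visc_off_speed i j => mino.
by apply: (interface_entropy grav_ge0 _ _ speed lamd d0 mino);
  exact: Ustar_admissible.
Qed.

Lemma sum_stencil_off_diag (T : zmodType) i (f : 'I_N -> T) : f i = 0 ->
  \sum_(j in stencil S i) f j = \sum_(j in stencil S i | j != i) f j.
Proof.
move=> fi; have [_ /(_ i) [ii _] _ _ _] := hS.
by rewrite (bigD1 i) //= fi add0r.
Qed.

Lemma visc_neq i j : j != i -> visc S U i j = dv i j.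
Proof. by rewrite /visc => /negPf ->. Qed.

(** Each summand is 2 d_ij (bar state - U_i).  Completing the fluxes to this form
    leaves the affine shift and terms linear in c_ij with coefficients that depend
    on i only; the latter add up to zero because the c_ij do. *)
Lemma sum_Flow i : eps S * hmax S <= depth (U i) ->
  \sum_(j in stencil S i) Flow S U i j
  = \sum_(j in stencil S i | j != i)
      (dv i j *: (Us i j + Us j i)
       - (flux g (Us j i) (c i j) - flux g (Us i j) (c i j))
       - (2 * dv i j) *: U i)
    + Bshift S U i.
Proof.
move=> hi; pose G j := visc S U i j *: (Us i j + Us j i)
       - (flux g (Us j i) (c i j) - flux g (Us i j) (c i j))
       - (2 * visc S U i j) *: U i.
have FG j : Flow S U i j = G j
   + (- 2 * (visc S U i j + dot (V i) (c i j))) *: (Us i j - U i)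
   - (2 * dot (V i) (c i j)) *: U i
   - mkstate 0 ((g * depth (U i) ^+ 2) *: c i j).
  rewrite /G /Flow !flux_Ustar; move: (Us i j) (Us j i) (visc _ _ _ _) => u v b.
  apply: state_eq.
    rewrite !(depthD, depthN, depthZ, depth_mk); ring.
  rewrite !(dischD, dischN, dischZ, disch_mk); apply/rowP => k.
  rewrite !mxE; ring.
have shift0 : \sum_(j in stencil S i) ((2 * dot (V i) (c i j)) *: U i) = 0.
  by rewrite -scaler_suml -mulr_sumr -dot_sumr sum_cij dot0r mulr0 scale0r.
have press0 : \sum_(j in stencil S i)
    mkstate 0 ((g * depth (U i) ^+ 2) *: c i j) = 0.
  apply: state_eq.
    rewrite depth0 depthE summxE big1 // => j _.
    by rewrite -depthE depth_mk.
  rewrite disch0 /disch linear_sum /=.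
  under eq_bigr do rewrite -/(disch _) disch_mk.
  by rewrite -scaler_sumr sum_cij scaler0.
under eq_bigr do rewrite FG.
rewrite 2!sumrB shift0 press0 !subr0 big_split /= -/(Bshift _ _ _); congr (_ + _).
rewrite sum_stencil_off_diag; first by apply: eq_bigr => j /andP[_ /visc_neq]; rewrite /G => ->.
by rewrite /G !Ustar_flat // subrr subr0 scalerDr mulr2n mulrDl !mul1r scalerDl subrr.
Qed.

(** The common source of both entropy inequalities: the first applies it to the
    tangent plane at U_i, the second to a minorant touching the entropy at the
    updated state. *)
Lemma low_order_minorant i a p : eps S * hmax S <= depth (U i) ->
  entropy_minorant g a p ->
  (\sum_(j in stencil S i | j != i) 2 * dv i j) * (a + dot p (U i))
  + dot p (\sum_(j in stencil S i) Flow S U i j) - dot p (Bshift S U i)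
  <= \sum_(j in stencil S i | j != i)
       (dv i j * (E (Us i j) + E (Us j i))
        - dot (F (Us j i) - F (Us i j)) (c i j)).
Proof.
move=> hi mino; rewrite sum_Flow // dotDr addrA addrK dot_sumr mulr_suml.
rewrite -big_split /=; apply: ler_sum => j _.
apply: le_trans (interface_entropy_Ustar i j mino).
rewrite [dot p (_ - _ - _)]dotBr dotZr; lra.
Qed.

Lemma sum_entropy_terms_off_diag (W : 'I_N -> 'I_N -> state R d) i :
  \sum_(j in stencil S i) (dot (F (W j i) - F (W i j)) (c i j)
       - visc S U i j * (E (W j i) - E (W i j)))
  = \sum_(j in stencil S i | j != i) (dot (F (W j i) - F (W i j)) (c i j)
       - dv i j * (E (W j i) - E (W i j))).
Proof.
rewrite sum_stencil_off_diag; last by rewrite !subrr dot0l mulr0 subrr.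
by apply: eq_bigr => j /andP[_ /visc_neq ->].
Qed.

(** The entropy inequality in the limit of a vanishing time step: the sum of the
    F_ij is m_i times the time derivative of U_i. *)
Lemma semidiscrete_entropy i : eps S * hmax S <= depth (U i) ->
  dot (entropy_var g (U i)) (\sum_(j in stencil S i) Flow S U i j)
  + \sum_(j in stencil S i) (dot (F (Us j i) - F (Us i j)) (c i j)
       - visc S U i j * (E (Us j i) - E (Us i j)))
  <= dot (entropy_var g (U i)) (Bshift S U i).
Proof.
move=> hi; have Ui : admissible (U i) by apply: wet_or_vacuum_admissible; left.
have := low_order_minorant hi (tangent_minorant grav_ge0 Ui).
rewrite subrK sum_entropy_terms_off_diag => min.
have : \sum_(j in stencil S i | j != i)
       (dv i j * (E (Us i j) + E (Us j i))
        - dot (F (Us j i) - F (Us i j)) (c i j))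
  <= (\sum_(j in stencil S i | j != i) 2 * dv i j) * E (U i)
     - \sum_(j in stencil S i | j != i) (dot (F (Us j i) - F (Us i j)) (c i j)
       - dv i j * (E (Us j i) - E (Us i j))).
  rewrite mulr_suml -sumrB; apply: ler_sum => j _.
  have := ler_wpM2l (visc_off_ge0 i j) (Eflat_Ustar_le j hi); lra.
lra.
Qed.

End Scheme.

Lemma low_order_updateE (R : realType) (d N : nat) (S : scheme R d N)
    (U U1 : 'I_N -> state R d) tau i : scheme_ok S -> 0 < tau ->
  low_order_update S U tau U1 ->
  U1 i = U i + (tau / mass S i) *: \sum_(j in stencil S i) Flow S U i j.
Proof.
move=> [_ _ /(_ i) m0 _ _] t0 /(_ i) <-.
have mt : tau / mass S i * (mass S i / tau) = 1 by field; rewrite !gt_eqF.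
by rewrite scalerA mt scale1r addrC subrK.
Qed.

(** The weight 1 - 2 tau |d_ii| / m_i of U_i in the convex combination is
    nonnegative. *)
Lemma cfl_visc_le (R : realType) (d N : nat) (S : scheme R d N)
    (U : 'I_N -> state R d) tau i : scheme_ok S -> (forall i, wet (U i)) ->
  0 < tau -> cfl S U tau ->
  \sum_(j in stencil S i | j != i) 2 * visc_off S U i j <= mass S i / tau.
Proof.
move=> hS hU t0 /(_ i); have [_ _ /(_ i) m0 _ _] := hS.
rewrite -mulr_sumr /visc eqxx; set D := \sum_(_ in _ | _) _.
have D0 : 0 <= D by apply: sumr_ge0 => j _; exact: visc_off_ge0.
rewrite oppr_eq0 normrN ger0_norm //; have [->|Dn0 /(_ isT)] := eqVneq D 0.
  by rewrite mulr0 divr_ge0 // ltW.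
have D1 : 0 < 2 * D by rewrite mulr_gt0 // lt_def Dn0 D0.
by rewrite !ler_pdivlMr // mulrC.
Qed.

Theorem proposition3p7 (R : realType) (d N : nat) (hd : d = 1%N \/ d = 2%N)
    (S : scheme R d N) (hS : scheme_ok S)
    (U : 'I_N -> state R d) (hU : forall i, wet (U i))
    (UL : R -> 'I_N -> state R d)
    (hUL : forall tau, 0 < tau -> low_order_update S U tau (UL tau)) :
  (forall i, eps S * hmax S <= depth (U i) ->
     exists r : R -> R,
       r =O_ (0^'+) (fun tau => tau) /\
       forall tau, 0 < tau -> cfl S U tau ->
         entropy_lhs S U tau (UL tau) (Ustar S U) i
         <= dot (grad_Eflat (grav S) (U i)) (Bshift S U i) + r tau)
  /\
  ((forall i, topo S i = 0) ->
   forall i, (forall j, j \in stencil S i -> eps S * hmax S <= depth (U j)) ->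
   forall tau, 0 < tau -> cfl S U tau ->
     entropy_lhs S U tau (UL tau) (fun k _ => U k) i <= 0).
Proof.
have g0 := grav_ge0 hS; have [_ in_stencil mass_gt0 _ _] := hS.
split=> [i hi|topo0 i hi tau tau0 hcfl].
  have m0 := mass_gt0 i.
  set G := \sum_(j in stencil S i) Flow S U i j.
  have [C [e [C0 e0 taylor]]] := Eflat_taylor G g0 (hU i).
  (* The O(tau) term is the positive part of the defect, which makes the
     inequality hold for every tau; only its size for small tau is at stake. *)
  pose excess tau := entropy_lhs S U tau (UL tau) (Ustar S U) i
    - dot (grad_Eflat (grav S) (U i)) (Bshift S U i).
  exists (fun tau => Num.max 0 (excess tau)); split; last first.
    by move=> tau _ _; rewrite -lerBlDl le_max lexx orbT.
  have k0 : 0 < C / mass S i + 1 by rewrite ltr_wpDl // divr_ge0 // ltW.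
  apply/eqO_exP; exists (C / mass S i + 1) => //.
  near=> tau; have tau0 : 0 < tau by [].
  rewrite (gtr0_norm tau0) ger0_norm ?le_max ?lexx //.
  rewrite ge_max mulr_ge0 ?(ltW k0) ?(ltW tau0) //=.
  have s0 : 0 < tau / mass S i by rewrite divr_gt0.
  have se : `|tau / mass S i| < e.
    rewrite gtr0_norm // ltr_pdivrMr //.
    by near: tau; apply: nbhs_right_lt; rewrite mulr_gt0.
  have := taylor _ se; rewrite -(low_order_updateE i hS tau0 (hUL _ tau0)).
  rewrite ler_norml => /andP[_].
  have := semidiscrete_entropy hS hU hi; rewrite -/G.
  rewrite /excess /entropy_lhs grad_EflatE //.
  set dE := Eflat _ (UL tau i) - Eflat _ (U i); set Sum := \sum_(_ in _) _.
  move=> semi rem.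
  have k0' : 0 <= mass S i / tau by rewrite divr_ge0 // ltW.
  have := ler_wpM2l k0' rem.
  set P := dot _ G in rem semi *.
  have -> : mass S i / tau * (dE - tau / mass S i * P) = mass S i / tau * dE - P.
    by field; rewrite !gt_eqF.
  have -> : mass S i / tau * (C * (tau / mass S i) ^+ 2) = C / mass S i * tau.
    by field; rewrite !gt_eqF.
  move: semi tau0; lra.
have ii : i \in stencil S i by case: (in_stencil i).
have m0 := mass_gt0 i; set k := mass S i / tau.
have k0 : 0 < k by rewrite divr_gt0.
have flat j : j \in stencil S i ->
    (Ustar S U i j = U i) * (Ustar S U j i = U j).
  by move=> js; rewrite !Ustar_flat ?hi ?topo0.
have B0 : Bshift S U i = 0.
  by rewrite /Bshift big1 // => j js; rewrite flat // subrr scaler0.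
(* In terms of K, the claim reads k E(U^{n+1}_i) <= K. *)
pose K := k * Eflat (grav S) (U i)
  - \sum_(j in stencil S i) (dot (Fflat (grav S) (U j) - Fflat (grav S) (U i)) (cij S i j)
       - visc S U i j * (Eflat (grav S) (U j) - Eflat (grav S) (U i))).
have minK a p : entropy_minorant (grav S) a p ->
    k * (a + dot p (UL tau i)) <= K.
  move=> mino; have := low_order_minorant hS hU (hi i ii) mino.
  rewrite B0 dot0r subr0 (low_order_updateE i hS tau0 (hUL _ tau0)) dotDr dotZr.
  set G := dot p (\sum_(_ in _) _).
  have -> : k * (a + (dot p (U i) + tau / mass S i * G))
      = k * (a + dot p (U i)) + G.
    by rewrite /k; field; rewrite !gt_eqF.
  rewrite /K (sum_entropy_terms_off_diag U hS (fun k _ => U k)).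
  have := cfl_visc_le i hS hU tau0 hcfl; rewrite -/k.
  set D := \sum_(_ in _ | _) 2 * _ => Dk.
  have Ui : admissible (U i) by apply: wet_or_vacuum_admissible; left.
  have kD : 0 <= k - D by rewrite subr_ge0.
  have := ler_wpM2l kD (mino _ Ui).
  set lhs := (X in D * _ + G <= X).
  have -> : lhs = D * Eflat (grav S) (U i)
    - \sum_(j in stencil S i | j != i)
       (dot (Fflat (grav S) (U j) - Fflat (grav S) (U i)) (cij S i j)
       - visc_off S U i j * (Eflat (grav S) (U j) - Eflat (grav S) (U i))).
    rewrite /lhs /D mulr_suml -sumrB; apply: eq_bigr => j /andP[js _].
    by rewrite !flat //; ring.
  lra.
(* A negative depth would let the minorants - t h exceed K. *)
have h1 : 0 <= depth (UL tau i).
  rewrite leNgt; apply/negP => h1.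
  have kh : 0 < k * - depth (UL tau i) by rewrite mulr_gt0 // oppr_gt0.
  have t0 : 0 <= (`|K| + 1) / (k * - depth (UL tau i)).
    by rewrite divr_ge0 ?addr_ge0 // ltW.
  have := minK _ _ (depth_minorant g0 t0).
  rewrite dot_state depth_mk disch_mk dot0l addr0 add0r.
  set t := (_ + 1) / _; set h := depth _.
  have -> : k * (- t * h) = t * (k * - h) by ring.
  by rewrite divfK ?gt_eqF //; have := ler_norm K; lra.
have [a [p [mino E1]]] := Eflat_supported g0 h1.
by have := minK _ _ mino; rewrite -E1 /K /entropy_lhs -/k; lra.
Unshelve. all: by end_near. Qed.
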